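(* Let $G$ be a metabelian $3$-group of coclass $1$ and order $3^m$, of nilpotency class $c=m-1\ge 2$ (so $m\ge 3$) and defect of commutativity $0\le k\le 1$. Assume that $G$ is isomorphic to the representative $G_\gamma^m(\beta,\alpha)$ with parameters $\alpha,\beta,\gamma\in\{-1,0,1\}$, where $\gamma=0$ for $m\le 4$, and let $x,y$ be the normalized generators of $G$ satisfying the relations of $G_\gamma^m(\beta,\alpha)$. Then the annihilator ideal $\mathfrak{A}=\mathfrak{A}(G)\unlhd\mathbb{Z}[X,Y]$ is $$\mathfrak{A}=\mathfrak{W}_{m-2}(\gamma):=\left(X^{m-2},\ Y-\gamma X^{m-3},\ T_3(X)\right),\qquad T_3(X):=X^2+3X+3.$$ In particular, if $k=0$, that is, $\gamma=0$, then $$\mathfrak{A}=\mathfrak{Y}_{m-2}:=\mathfrak{W}_{m-2}(0)=\left(X^{m-2},\ Y,\ T_3(X)\right).$$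
   Context: Conventions: $[a,b]=a^{-1}b^{-1}ab$, $t^g=g^{-1}tg$. The lower central series is $\gamma_1(G)=G$, $\gamma_j(G)=[\gamma_{j-1}(G),G]$; $G'=\gamma_2(G)$; $m$ is the index of nilpotency ($\gamma_m(G)=1\ne\gamma_{m-1}(G)$); coclass $=\log_3|G|-$ class. $\zeta_j(G)$ is the upper central series. Annihilator: for a finite metabelian group $G=\langle x,y\rangle$ put $s_2=[y,x]$. Conjugation makes the abelian group $G'$ a $\mathbb{Z}[G]$-module, $t^{ag+bh}=(t^g)^a(t^h)^b$ for $a,b\in\mathbb{Z}$, $g,h\in G$ (so $t^{x-1}=[t,x]$, $t^{y-1}=[t,y]$; the actions of $x$ and $y$ on $G'$ commute). The annihilator (with respect to the generators $x,y$) is the ideal $\mathfrak{A}(G)=\{f\in\mathbb{Z}[X,Y] : s_2^{f(x-1,y-1)}=1\}$. Two-step centralizer: $\chi_2(G)=\{g\in G : [u,g]\in\gamma_4(G)\text{ for all }u\in\gamma_2(G)\}$. Normalized generators $x,y$ of $G$: $x\in G\setminus\chi_2(G)$ if $m\ge 4$, and $y\in\chi_2(G)\setminus\gamma_2(G)$. Put $s_j=[s_{j-1},x]$ for $j\ge 3$. Defect $k$: $[\gamma_2(G),\chi_2(G)]=\gamma_{m-k}(G)$ (for $m\ge 4$; $k=0$ for $m=3$); $k=0\Leftrightarrow\gamma=0$ and $k=1\Leftrightarrow\gamma=\pm1$. Representative $G_\gamma^m(\beta,\alpha)$ (Blackburn, Miech, Nebelung): the metabelian $3$-group of maximal class of order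 $3^m$ whose normalized generators $x,y$ satisfy (power relations) $x^3=s_{m-1}^\alpha$, $\ y^3s_2^3s_3=s_{m-1}^\beta$, $\ s_j^3s_{j+1}^3s_{j+2}=1$ for all $j\ge 2$; (commutator relations) $[s_2,y]=s_{m-1}^\gamma$, $[s_j,y]=1$ for all $j\ge 3$; (nilpotency relations) $s_j\ne 1$ for $2\le j\le m-1$, $s_j=1$ for $j\ge m$, with $\gamma_j(G)=\langle s_j,\gamma_{j+1}(G)\rangle$ and $\gamma_j(G)/\gamma_{j+1}(G)\simeq C_3$ for $2\le j\le m-1$; (metabelian relations) $[s_i,s_j]=1$ for $i,j\ge 2$. *)

(* Defs.v *)
From HB Require Import structures.
From mathcomp Require Import all_boot all_order all_algebra all_fingroup all_solvable.
From mathcomp Require Export mpoly.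

Set Implicit Arguments.
Unset Strict Implicit.
Unset Printing Implicit Defensive.

Import GroupScope GRing.Theory.

(* Conventions inherited from the library: [~ a, b] = a^-1 b^-1 a b,
   t ^ g = g^-1 t g, and 'L_j(G) = gamma_j(G) with 'L_1(G) = G. *)

Definition expgz (gT : finGroupType) (t : gT) (a : int) : gT :=
  match a with Posz n => t ^+ n | Negz n => t ^- n.+1 end.

(* The integral group ring: formal sums \sum_g a(g) g, with the convolution
   product (the pointwise product of {ffun gT -> int} is not used). *)
Definition zgring (gT : finGroupType) : Type := {ffun gT -> int}.

Section GroupRing.
Local Open Scope ring_scope.
Variable gT : finGroupType.

HB.instance Definition _ := GRing.Zmodule.copy (zgring gT) {ffun gT -> int}.

Implicit Types a b c : {ffun gT -> int}.

Definition zg (g : gT) : zgring gT := [ffun h : gT => (h == g)%:R : int].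

Definition zgring_mul (a b : zgring gT) : zgring gT :=
  [ffun g : gT =>
     \sum_(h : gT) (a : {ffun gT -> int}) h
                   * (b : {ffun gT -> int}) (h^-1 * g)%g].

Fact zgring_mulA : associative zgring_mul.
Proof.
move=> a b c; apply/ffunP=> g; rewrite !ffunE.
under eq_bigr => h _ do rewrite ffunE mulr_sumr.
under [RHS]eq_bigr => k _ do rewrite ffunE mulr_suml.
rewrite [RHS]exchange_big /=; apply: eq_bigr => h _.
rewrite (reindex_inj (mulgI h^-1)%g) /=; apply: eq_bigr => k _.
by rewrite mulrA invMg invgK -mulgA mulKVg.
Qed.

Fact zgring_mul1 : left_id (zg 1%g) zgring_mul.
Proof.
move=> a; apply/ffunP=> g; rewrite !ffunE (bigD1 1%g) //= big1 => [|h /negPf n1].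
  by rewrite ffunE eqxx mul1r invg1 mul1g addr0.
by rewrite ffunE n1 mul0r.
Qed.

Fact zgring_1mul : right_id (zg 1%g) zgring_mul.
Proof.
move=> a; apply/ffunP=> g; rewrite !ffunE (bigD1 g) //= big1 => [|h /negPf n1].
  by rewrite ffunE mulVg eqxx mulr1 addr0.
by rewrite ffunE -eq_mulVg1 n1 mulr0.
Qed.

Fact zgring_mulDl : left_distributive zgring_mul +%R.
Proof.
move=> a b c; apply/ffunP=> g; rewrite !ffunE -big_split /=.
by apply: eq_bigr => h _; rewrite ffunE mulrDl.
Qed.

Fact zgring_mulDr : right_distributive zgring_mul +%R.
Proof.
move=> a b c; apply/ffunP=> g; rewrite !ffunE -big_split /=.
by apply: eq_bigr => h _; rewrite ffunE mulrDr.
Qed.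

Fact zgring_1neq0 : zg 1%g != 0.
Proof.
by apply/eqP=> /ffunP/(_ 1%g); rewrite !ffunE eqxx => /eqP; rewrite oner_eq0.
Qed.

HB.instance Definition _ := GRing.Zmodule_isNzRing.Build (zgring gT)
  zgring_mulA zgring_mul1 zgring_1mul zgring_mulDl zgring_mulDr zgring_1neq0.

End GroupRing.

(* t^a for a in Z[gT].  The order of the factors is irrelevant for t in G'
   and a supported on a metabelian group G, the only case that is used. *)
Definition zact (gT : finGroupType) (t : gT) (a : zgring gT) : gT :=
  \prod_(g : gT) expgz (t ^ g) ((a : {ffun gT -> int}) g).

Section Polynomials.
Local Open Scope ring_scope.

Definition pX : {mpoly int[2]} := 'X_(0 : 'I_2).
Definition pY : {mpoly int[2]} := 'X_(1 : 'I_2).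
Definition T3 : {mpoly int[2]} := pX ^+ 2 + 3 * pX + 3.

(* f(x-1, y-1).  As x-1 and y-1 need not commute in Z[G], the monomial X^iY^j
   is sent to (x-1)^i (y-1)^j; this ordering is immaterial on the module G',
   where the actions of x and y commute. *)
Definition eval_xy (gT : finGroupType) (x y : gT) (f : {mpoly int[2]}) :
    zgring gT :=
  mmap intr (fun i : 'I_2 => zg (if i == 0 then x else y) - 1) f.

Definition annihilator (gT : finGroupType) (x y : gT) (f : {mpoly int[2]}) :
    Prop :=
  zact [~ y, x]%g (eval_xy x y f) = 1%g.

Definition ideal_gen (R : comNzRingType) (s : seq R) (f : R) : Prop :=
  exists c : 'I_(size s) -> R, f = \sum_(i < size s) c i * s`_i.

Definition W_ideal (n : nat) (gamma : int) : {mpoly int[2]} -> Prop :=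
  ideal_gen [:: pX ^+ n; pY - gamma *: pX ^+ (n - 1); T3].

Definition Y_ideal (n : nat) : {mpoly int[2]} -> Prop :=
  ideal_gen [:: pX ^+ n; pY; T3].

End Polynomials.

Section MaximalClass.
Variable gT : finGroupType.
Implicit Types (G : {group gT}) (x y : gT) (m j k : nat).

Definition metabelian G : bool := abelian G^`(1).

Definition coclass (p : nat) G : nat := logn p #|G| - nil_class G.

Definition chi2 G : {set gT} :=
  [set g in G | [forall u in 'L_2(G), [~ u, g] \in 'L_4(G)]].

(* Here m is the index of nilpotency of G. *)
Definition has_defect G m k : Prop :=
  if m < 4 then k = 0%N else [~: 'L_2(G), chi2 G] = 'L_(m - k)(G).

Definition normalized_generators G m x y : Prop :=
  [/\ <<[set x; y]>> = G,
      x \in G,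
      4 <= m -> x \notin chi2 G &
      y \in chi2 G :\: 'L_2(G)].

(* s_2 = [y, x] and s_j = [s_{j-1}, x]; only used for j >= 2. *)
Definition s_ x y j : gT := iter (j - 2) (fun t => [~ t, x]) [~ y, x].

(* G is the group G_gamma^m(beta, alpha), presented on the generators x, y. *)
Record is_representative m (alpha beta gamma : int) G x y : Prop :=
  IsRepresentative {
    rep_gens : normalized_generators G m x y;
    rep_x3 : x ^+ 3 = expgz (s_ x y m.-1) alpha;
    rep_y3 : y ^+ 3 * s_ x y 2 ^+ 3 * s_ x y 3 = expgz (s_ x y m.-1) beta;
    rep_s3 : forall j, 2 <= j ->
      s_ x y j ^+ 3 * s_ x y j.+1 ^+ 3 * s_ x y j.+2 = 1;
    rep_s2y : [~ s_ x y 2, y] = expgz (s_ x y m.-1) gamma;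
    rep_sjy : forall j, 3 <= j -> [~ s_ x y j, y] = 1;
    rep_sj_neq1 : forall j, 2 <= j <= m.-1 -> s_ x y j != 1;
    rep_sj_eq1 : forall j, m <= j -> s_ x y j = 1;
    rep_lcn : forall j, 2 <= j <= m.-1 ->
      'L_j(G) = <<s_ x y j |: 'L_j.+1(G)>>;
    rep_lcn_quo : forall j, 2 <= j <= m.-1 ->
      'L_j(G) / 'L_j.+1(G) \isog Zp 3;
    rep_metab : forall i j, 2 <= i -> 2 <= j -> [~ s_ x y i, s_ x y j] = 1
  }.

End MaximalClass.

(* Main.v *)
From HB Require Import structures.
Require Import Defs.
From mathcomp Require Import all_boot all_order all_algebra all_fingroup all_solvable.
From mathcomp Require Import ring.

Set Implicit Arguments.
Unset Strict Implicit.
Unset Printing Implicit Defensive.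

Import GroupScope GRing.Theory FiniteModule.

(** The commutator subgroup G', written additively, is a module over Z[G], and
    since it is abelian the actions of x and y on it commute; hence it is a
    module over Z[X, Y], with X and Y acting as x - 1 and y - 1, and the
    annihilator of s_2 = [y, x] is an honest ideal.  The element X^j sends s_2
    to s_(j+2), so the defining relations of the representative say
    that X^(m-2), Y - gamma X^(m-3) and T_3 kill s_2.  This gives one inclusion.

    For the other one, modulo the last two generators Y is a multiple of X and
    3 = -X (X + 3) is one too.  So if f kills s_2 and f = p X^i + ... modulo
    these generators, only the constant term c of p is visible in
    gamma_(i+2) / gamma_(i+3), where f sends s_2 to the class of s_(i+2)^c.
    That section has order 3 and is generated by s_(i+2), hence 3 divides c,
    the whole of p X^i is a multiple of X^(i+1), and induction on i reaches the
    exponent m - 2 (lemma [polyact_lcn_ideal]).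

    For the defect, let m >= 4.  As y centralises every s_j with j >= 3, and
    [s_2, y] is s_(m-1)^gamma, y centralises G' if and only if gamma = 0.  As the
    two-step centraliser is generated by y and G', this decides whether
    [gamma_2, chi_2] is trivial (lemma [commg_chi2_eq1]). *)

(** * The action of the integral group ring on an abelian subgroup *)

Section GroupRingAction.

Local Open Scope ring_scope.
Variables (gT : finGroupType) (A : {group gT}) (abA : abelian A).
Local Notation V := (fmod_of abA).
Implicit Types (u v : V) (a b : zgring gT) (g h : gT).

Definition coef a g : int := (a : {ffun gT -> int}) g.

(** [zact] ranges over all of gT, whereas only elements normalising A act on
    it; the two notions of action agree on the combinations of the latter. *)
Definition norm_supported : {pred zgring gT} :=
  fun a => [forall g, (g \notin 'N(A)) ==> (coef a g == 0)].

Lemma norm_supportedP a :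
  reflect (forall g, g \notin 'N(A) -> coef a g = 0) (a \in norm_supported).
Proof.
apply: (iffP forallP) => [Sa g nNg | Sa g].
  by apply/eqP/(implyP (Sa g)).
by apply/implyP => /Sa->.
Qed.

Lemma zg_norm_supported g : g \in 'N(A) -> zg g \in norm_supported.
Proof.
move=> Ng; apply/norm_supportedP => h nNh; rewrite /coef ffunE.
by case: eqP nNh => // ->; rewrite Ng.
Qed.

Fact norm_supported_subring : subring_closed norm_supported.
Proof.
split=> [|a b /norm_supportedP Sa /norm_supportedP Sb
         |a b /norm_supportedP Sa /norm_supportedP Sb].
- exact/zg_norm_supported/group1.
- apply/norm_supportedP => g nNg.
  have -> : coef (a - b) g = coef a g - coef b g by rewrite /coef !ffunE.
  by rewrite Sa ?Sb ?subrr.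
apply/norm_supportedP => g nNg; rewrite /coef ffunE big1 // => h _.
have [Nh | nNh] := boolP (h \in 'N(A)).
  by rewrite -/(coef b _) Sb ?mulr0 // groupMl ?groupV.
by rewrite -/(coef a _) Sa ?mul0r.
Qed.

HB.instance Definition _ :=
  GRing.isSubringClosed.Build (zgring gT) norm_supported norm_supported_subring.

Definition zgact u a : V := \sum_(g in 'N(A)) (u ^@ g) *~ coef a g.

Lemma zgactDr u : {morph zgact u : a b / a + b}.
Proof.
move=> a b; rewrite /zgact -big_split /=; apply: eq_bigr => g _.
by rewrite -mulrzDr /coef ffunE.
Qed.

Lemma zgactNr u : {morph zgact u : a / - a}.
Proof.
move=> a; rewrite /zgact -sumrN; apply: eq_bigr => g _.
by rewrite -mulrNz /coef ffunE.
Qed.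

Lemma zgactr0 u : zgact u 0 = 0.
Proof. by rewrite -(subrr 0) zgactDr zgactNr subrr. Qed.

Lemma zgactZr u a c : zgact u (c%:~R * a) = zgact u a *~ c.
Proof.
have aux n : zgact u (a *+ n) = zgact u a *+ n.
  by elim: n => [|n IHn]; rewrite ?zgactr0 // !mulrS zgactDr IHn.
by rewrite mulrzl; case: c => n; rewrite ?NegzE ?mulrNz ?zgactNr -!pmulrn aux.
Qed.

Lemma zgactDl a : {morph zgact^~ a : u v / u + v}.
Proof.
move=> u v; rewrite /zgact -big_split /=; apply: eq_bigr => g _.
by rewrite actAr mulrzDl.
Qed.

Lemma zgact0l a : zgact 0 a = 0.
Proof. by rewrite /zgact big1 // => g _; rewrite act0r mul0rz. Qed.

Lemma zgact_zg u g : g \in 'N(A) -> zgact u (zg g) = u ^@ g.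
Proof.
move=> Ng; rewrite /zgact (bigD1 g) //= big1 => [|h /andP[_ /negPf ne]].
  by rewrite /coef ffunE eqxx addr0.
by rewrite /coef ffunE ne.
Qed.

Lemma zgact1 u : zgact u 1 = u.
Proof. by rewrite zgact_zg ?group1 // actr1. Qed.

Lemma actr_mulrz u g c : (u *~ c) ^@ g = (u ^@ g) *~ c.
Proof. by case: c => n; rewrite ?NegzE ?mulrNz -!pmulrn ?actNr actZr. Qed.

(** The support condition matters because elements off the normaliser act as
    zero, while a product of two of them may fall back into it. *)
Lemma zgactM u a b :
  a \in norm_supported -> zgact u (a * b) = zgact (zgact u a) b.
Proof.
move/norm_supportedP=> Sa; rewrite /zgact.
transitivity (\sum_(h in 'N(A)) \sum_(g in 'N(A))
                 u ^@ g *~ (coef a h * coef b (h^-1 * g)%g)).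
  rewrite exchange_big /=; apply: eq_bigr => g _.
  rewrite /coef ffunE [in LHS](bigID [in 'N(A)]) /= [X in _ + X]big1 ?addr0.
    by rewrite -mulrz_sumr.
  by move=> h nNh; rewrite -/(coef a _) Sa ?mul0r.
transitivity (\sum_(h in 'N(A)) \sum_(g in 'N(A))
                 (u ^@ h ^@ g) *~ (coef a h * coef b g)).
  apply: eq_bigr => h Nh; rewrite (reindex_inj (mulgI h)) /=.
  apply: eq_big => [g | g Ng]; first by rewrite groupMl.
  by rewrite mulKg actrM // -(groupMl _ Nh).
rewrite exchange_big /=; apply: eq_bigr => g Ng.
rewrite actr_sum mulrz_suml; apply: eq_bigr => h Nh.
by rewrite actr_mulrz mulrzA.
Qed.

Lemma fmval_mulrz u c : fmval (u *~ c) = expgz (fmval u) c.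
Proof. by case: c => n; rewrite ?NegzE ?mulrNz -!pmulrn ?fmvalN ?fmvalZ. Qed.

Lemma zactE u a : a \in norm_supported -> zact (fmval u) a = fmval (zgact u a).
Proof.
move/norm_supportedP=> Sa; rewrite /zact /zgact fmval_sum [RHS]big_mkcond /=.
apply: eq_bigr => g _; case: ifPn => [Ng | /Sa]; last by rewrite /coef => ->.
by rewrite -fmvalJ // fmval_mulrz.
Qed.

End GroupRingAction.

(** * The action of integral polynomials *)

Section PolynomialAction.

Local Open Scope ring_scope.
Variables (gT : finGroupType) (A : {group gT}) (abA : abelian A).
Variables (x y : gT).
Hypotheses (Nx : x \in 'N(A)) (Ny : y \in 'N(A)) (Axy : [~ x, y]%g \in A).
Local Notation V := (fmod_of abA).
Local Notation Dx := (fun v : V => zgact v (zg x - 1)).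
Local Notation Dy := (fun v : V => zgact v (zg y - 1)).
Implicit Types (u v : V) (f p q : {mpoly int[2]}).

Definition polyact u f : V := zgact u (eval_xy x y f).

Lemma eval_xyX (m : 'X_{1..2}) :
  eval_xy x y 'X_[m] = (zg x - 1) ^+ m ord0 * (zg y - 1) ^+ m (lift ord0 ord0).
Proof. by rewrite /eval_xy mmapX /mmap1 !big_ord_recl big_ord0 mulr1. Qed.

Lemma zg_sub1_supported g : g \in 'N(A) -> zg g - 1 \in norm_supported A.
Proof. by move=> Ng; rewrite rpredB ?rpred1 ?zg_norm_supported. Qed.

Lemma eval_xy_supported f : eval_xy x y f \in norm_supported A.
Proof.
rewrite /eval_xy /mmap rpred_sum // => m _; rewrite rpredM ?rpred_int //.
rewrite /mmap1 rpred_prod // => i _; rewrite rpredX // zg_sub1_supported //.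
by case: ifP.
Qed.

Lemma zgact_sub1 u g : g \in 'N(A) -> zgact u (zg g - 1) = u ^@ g - u.
Proof. by move=> Ng; rewrite zgactDr zgactNr zgact1 zgact_zg. Qed.

Lemma zgact_exp u a n :
  a \in norm_supported A -> zgact u (a ^+ n) = iter n (fun v : V => zgact v a) u.
Proof.
move=> Sa; elim: n u => [|n IHn] u; first exact: zgact1.
by rewrite exprS zgactM // IHn -iterSr.
Qed.

Lemma actr_abelian u g : g \in A -> u ^@ g = u.
Proof.
move=> Ag; apply: val_inj; rewrite fmvalJ ?(subsetP (normG A)) //.
by apply/conjg_fixP/commgP/(centsP abA); rewrite ?fmodP.
Qed.

(** Here the commutativity of A enters: xy and yx differ by the commutator of
    x and y, which lies in A and so acts trivially. *)
Lemma zgact_xyC u :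
  zgact (zgact u (zg x - 1)) (zg y - 1) = zgact (zgact u (zg y - 1)) (zg x - 1).
Proof.
have xyC: u ^@ x ^@ y = u ^@ y ^@ x.
  have Nxy := subsetP (normG A) _ Axy.
  rewrite -(actrM Nx Ny) commgC (actrM (groupM Ny Nx) Nxy) (actrM Ny Nx).
  exact: actr_abelian Axy.
by rewrite !zgact_sub1 // !actAr !actNr xyC !opprD !addrA [_ - _ - u ^@ x]addrAC.
Qed.

Lemma polyactDr u : {morph polyact u : f p / f + p}.
Proof. by move=> f p; rewrite /polyact /eval_xy mmapD zgactDr. Qed.

Lemma polyactNr u : {morph polyact u : f / - f}.
Proof. by move=> f; rewrite /polyact /eval_xy mmapN zgactNr. Qed.

Lemma polyactr0 u : polyact u 0 = 0.
Proof. by rewrite /polyact /eval_xy mmap0 zgactr0. Qed.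

Lemma polyactZr u c f : polyact u (c *: f) = polyact u f *~ c.
Proof. by rewrite /polyact /eval_xy mmapZ zgactZr. Qed.

Lemma polyactC u c : polyact u c%:MP = u *~ c.
Proof. by rewrite /polyact /eval_xy mmapC -[X in zgact u X]mulr1 zgactZr zgact1. Qed.

Lemma polyactDl f : {morph (fun w : V => polyact w f) : u v / u + v}.
Proof. by move=> u v; rewrite /polyact zgactDl. Qed.

Lemma polyact0l f : polyact 0 f = 0. Proof. exact: zgact0l. Qed.

Lemma polyact_mulrz u f c : polyact (u *~ c) f = polyact u f *~ c.
Proof.
have aux n : polyact (u *+ n) f = polyact u f *+ n.
  by elim: n => [|n IHn]; rewrite ?polyact0l // !mulrS polyactDl IHn.
have auxN v : polyact (- v) f = - polyact v f.
  by apply: (addrI (polyact v f)); rewrite -polyactDl !subrr polyact0l.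
by case: c => n; rewrite ?NegzE ?mulrNz ?auxN -!pmulrn aux.
Qed.

Lemma polyact_mpolyX u (m : 'X_{1..2}) :
  polyact u 'X_[m] = iter (m (lift ord0 ord0)) Dy (iter (m ord0) Dx u).
Proof.
have Sx := zg_sub1_supported Nx; have Sy := zg_sub1_supported Ny.
by rewrite /polyact eval_xyX zgactM ?rpredX // !zgact_exp.
Qed.

(** [eval_xy] is not multiplicative, because x - 1 and y - 1 need not commute in
    the group ring; its action on the module is, because their actions commute. *)
Lemma polyactM u f p : polyact u (f * p) = polyact (polyact u f) p.
Proof.
have iterC i j v :
    iter i Dx (iter j Dy v) = iter j Dy (iter i Dx v).
  elim: i => //= i ->; elim: j (iter i _ v) => //= j IHj w.
  by rewrite -IHj zgact_xyC.
have polyactXX m n v : polyact v 'X_[m + n] = polyact (polyact v 'X_[m]) 'X_[n].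
  rewrite !polyact_mpolyX !mnmDE ![(m _ + n _)%N]addnC !iterD.
  by congr (iter _ _ _); rewrite iterC.
have polyactMX m q v : polyact v ('X_[m] * q) = polyact (polyact v 'X_[m]) q.
  elim/mpolyind: q => [|c n q _ _ IHq]; first by rewrite mulr0 !polyactr0.
  rewrite mulrDr !polyactDr {}IHq -{1}mul_mpolyC mulrCA mul_mpolyC -mpolyXD.
  by rewrite !polyactZr polyactXX.
elim/mpolyind: f => [|c n q _ _ IHq]; first by rewrite mul0r !polyactr0 polyact0l.
by rewrite mulrDl !polyactDr {}IHq polyactDl -{1}mul_mpolyC -mulrA mul_mpolyC
  !polyactZr polyactMX polyact_mulrz.
Qed.

Lemma polyactXr u : polyact u pX = u ^@ x - u.
Proof. by rewrite /pX polyact_mpolyX !mnm1E /= zgact_sub1. Qed.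

Lemma polyactYr u : polyact u pY = u ^@ y - u.
Proof. by rewrite /pY polyact_mpolyX !mnm1E /= zgact_sub1. Qed.

Lemma zact_eval_xy u f : zact (fmval u) (eval_xy x y f) = fmval (polyact u f).
Proof. by rewrite zactE ?eval_xy_supported. Qed.

Lemma polyact_mulrn u f k : polyact u (k%:R * f) = polyact u f *+ k.
Proof.
by elim: k => [|k IHk]; rewrite ?mul0r ?polyactr0 // !mulrS mulrDl mul1r polyactDr IHk.
Qed.

Lemma polyact1 u : polyact u 1 = u. Proof. by rewrite -mpolyC1 polyactC. Qed.

Lemma fmval_actr_sub u g :
  g \in 'N(A) -> fmval (u ^@ g - u) = [~ fmval u, g]%g.
Proof. by move=> Ng; rewrite addrC fmvalA fmvalN fmvalJ // commgEl. Qed.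

Lemma actr_sub_fmod s g :
  s \in A -> g \in 'N(A) -> fmod abA s ^@ g - fmod abA s = fmod abA [~ s, g]%g.
Proof.
move=> As Ng; apply: val_inj; rewrite /= fmval_actr_sub // !fmodK //.
by rewrite commgEl groupM ?groupV // memJ_norm.
Qed.

Lemma fmod_expgz s c : s \in A -> fmod abA (expgz s c) = fmod abA s *~ c.
Proof.
move=> As; apply: val_inj; rewrite /= fmval_mulrz !fmodK //.
by case: c => n; rewrite /= ?groupV groupX.
Qed.

Lemma mulrz_closed (W : {group gT}) u c : fmval u \in W -> fmval (u *~ c) \in W.
Proof. by move=> Wu; rewrite fmval_mulrz; case: c => n; rewrite /= ?groupV groupX. Qed.

Lemma actr_sub_closed (W : {group gT}) u g :
  g \in 'N(A) -> g \in 'N(W) -> fmval u \in W -> fmval (u ^@ g - u) \in W.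
Proof.
by move=> Ng NWg Wu; rewrite fmval_actr_sub // commgEl groupM ?groupV ?memJ_norm.
Qed.

Lemma polyact_closed (W : {group gT}) u f :
  x \in 'N(W) -> y \in 'N(W) -> fmval u \in W -> fmval (polyact u f) \in W.
Proof.
move=> NWx NWy Wu; elim/mpolyind: f => [|c m f _ _ IHf].
  by rewrite polyactr0 fmval0 group1.
rewrite polyactDr polyactZr fmvalA groupM // mulrz_closed // polyact_mpolyX.
elim: (m _) => [|j IHj] /=; last by rewrite zgact_sub1 // actr_sub_closed.
by elim: (m _) => [|i IHi] //=; rewrite zgact_sub1 // actr_sub_closed.
Qed.

End PolynomialAction.

(** * Ideals of Z[X, Y] *)

Section Polynomials.

Local Open Scope ring_scope.

Lemma ideal_gen3P (R : comNzRingType) (a b c f : R) :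
  ideal_gen [:: a; b; c] f <-> exists p q r, f = p * a + q * b + r * c.
Proof.
split=> [[e ->] | [p [q [r ->]]]].
  exists (e ord0), (e (lift ord0 ord0)), (e (lift ord0 (lift ord0 ord0))).
  by rewrite !big_ord_recl big_ord0 addr0 addrA.
exists (fun i => [:: p; q; r]`_i).
by rewrite !big_ord_recl big_ord0 addr0 addrA.
Qed.

Lemma mpoly2_decomp (f : {mpoly int[2]}) :
  exists c g h, f = c%:MP + pX * g + pY * h.
Proof.
elim/mpolyind: f => [|c m f _ _ [d [g [h ->]]]].
  by exists 0, 0, 0; rewrite !mulr0 !addr0.
have XU i : m i != 0%N -> 'X_[m] = 'X_i * 'X_[m - U_(i)] :> {mpoly int[2]}.
  by rewrite -lep1mP => le_m; rewrite -mpolyXD addmC submK.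
have [m0 | /XU->] := eqVneq (m 0) 0%N; last first.
  exists d, (c *: 'X_[m - U_(0)] + g), h.
  by rewrite -/pX -!mul_mpolyC; ring.
have [m1 | /XU->] := eqVneq (m 1) 0%N; last first.
  exists d, g, (c *: 'X_[m - U_(1)] + h).
  by rewrite -/pY -!mul_mpolyC; ring.
have -> : m = 0%MM.
  apply/mnmP=> i; rewrite mnm0E.
  by have [->|->] : i = 0 \/ i = 1; first by case: i => [[|[|]] //= lt2];
     [left|right]; apply: val_inj.
exists (c + d), g, h.
by rewrite mpolyX0 mpolyCD alg_mpolyC; ring.
Qed.

End Polynomials.

(** * Metabelian groups of maximal class *)

Section MaximalClass.

Variables (gT : finGroupType) (G : {group gT}) (n : nat).
Variables (alpha beta gamma : int) (x y : gT).
Hypotheses (abL2 : abelian 'L_2(G)%G) (nilG : 'L_n.+3(G) = 1).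
Hypothesis gamma0 : n = 0%N -> gamma = 0%R.
Hypothesis repG : is_representative n.+3 alpha beta gamma G x y.

Local Notation V := (fmod_of abL2).
Local Notation s j := (s_ x y j).

Let G_gen : <<[set x; y]>> = G. Proof. by case: (rep_gens repG). Qed.
Let Gx : x \in G. Proof. by rewrite -G_gen mem_gen ?set21. Qed.
Let Gy : y \in G. Proof. by rewrite -G_gen mem_gen ?set22. Qed.
Let Nx j : x \in 'N('L_j(G)). Proof. exact: subsetP (lcn_norm j G) _ Gx. Qed.
Let Ny j : y \in 'N('L_j(G)). Proof. exact: subsetP (lcn_norm j G) _ Gy. Qed.
Let N2x : x \in 'N('L_2(G)%G). Proof. exact: Nx 2. Qed.
Let N2y : y \in 'N('L_2(G)%G). Proof. exact: Ny 2. Qed.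
Let L2_comm : [~ x, y] \in 'L_2(G)%G. Proof. exact: mem_commg. Qed.

Lemma s_succ j : s j.+3 = [~ s j.+2, x].
Proof. by rewrite /s_ !subSS !subn0 iterS. Qed.

Lemma s_lcn j : s j.+2 \in 'L_j.+2(G).
Proof.
elim: j => [|j IHj]; first exact: mem_commg.
by rewrite s_succ lcnSn mem_commg.
Qed.

Lemma s_L2 j : s j.+2 \in 'L_2(G)%G.
Proof. exact: subsetP (lcn_sub_leq G _) _ (s_lcn j). Qed.

(** The index counts the factors X that produce the element from s_2. *)
Definition fmod_s j : V := fmod _ (s j.+2).

Lemma fmval_fmod_s j : fmval (fmod_s j) = s j.+2.
Proof. exact: fmodK (s_L2 j). Qed.

Local Open Scope ring_scope.
Local Notation act := (@polyact _ 'L_2(G)%G abL2 x y).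

Lemma polyact_sX j : act (fmod_s j) pX = fmod_s j.+1.
Proof. by rewrite polyactXr // /fmod_s actr_sub_fmod ?s_L2 // -s_succ. Qed.

Lemma polyact_sXn j : act (fmod_s 0) (pX ^+ j) = fmod_s j.
Proof.
elim: j => [|j IHj]; first by rewrite expr0 polyact1.
by rewrite exprSr polyactM // IHj polyact_sX.
Qed.

Lemma fmod_s_eq0 : fmod_s n.+1 = 0.
Proof. by rewrite /fmod_s (rep_sj_eq1 repG) // fmod1. Qed.

Lemma fmod_s_cubic j : fmod_s j *+ 3 + fmod_s j.+1 *+ 3 + fmod_s j.+2 = 0.
Proof.
apply: val_inj; rewrite /= 2!fmvalA !fmvalZ /= !fmval_fmod_s.
exact: (rep_s3 repG).
Qed.

Lemma polyact_T3 : act (fmod_s 0) T3 = 0.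
Proof.
rewrite /T3 2!polyactDr polyact_sXn polyact_mulrn polyact_sX -[3]mulr1.
by rewrite polyact_mulrn polyact1 addrC [fmod_s 2 + _]addrC addrA fmod_s_cubic.
Qed.

Lemma polyact_Y : act (fmod_s 0) (pY - gamma *: pX ^+ n) = 0.
Proof.
rewrite polyactDr polyactNr polyactZr polyact_sXn polyactYr //.
rewrite [fmod_s 0]/fmod_s actr_sub_fmod ?s_L2 //.
by rewrite (rep_s2y repG) fmod_expgz ?subrr ?s_L2.
Qed.

Lemma s_notin_lcn j : (j <= n)%N -> s j.+2 \notin 'L_j.+3(G).
Proof.
move=> le_jn; have le_j2 : (2 <= j.+2 <= n.+3.-1)%N by [].
apply/negP => Ls; have := rep_lcn_quo repG le_j2.
rewrite (rep_lcn repG le_j2) (setUidPr _) ?sub1set // genGid trivg_quotient.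
by move/card_isog; rewrite cards1 card_Zp.
Qed.

(** The element s_(j+2) lies outside the next term of the lower central series,
    but the relation s_j^3 s_(j+1)^3 s_(j+2) = 1 puts its cube inside; a
    multiplier prime to 3 would bring s_(j+2) itself inside. *)
Lemma mulrz_fmod_s_lcn j c :
  (j <= n)%N -> fmval (fmod_s j *~ c) \in 'L_j.+3(G) -> exists d, c = 3 * d.
Proof.
move=> le_jn Lc; have /negP nLs := s_notin_lcn le_jn.
have Ls3 : fmval (fmod_s j *+ 3) \in 'L_j.+3(G).
  have := fmod_s_cubic j; rewrite -addrA => /eqP; rewrite addr_eq0 => /eqP->.
  rewrite fmvalN groupV fmvalA fmvalZ /= !fmval_fmod_s groupM ?groupX ?s_lcn //.
  exact: subsetP (lcn_subS _ _) _ (s_lcn _).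
exists (c %/ 3)%Z; have := divz_eq c 3; have := modz_ge0 c (isT : 3 != 0 :> int).
have := ltz_pmod c (isT : 0 < 3 :> int).
case: (c %% 3)%Z => // r lt_r3 _ def_c.
have Lr : fmval (fmod_s j *+ r) \in 'L_j.+3(G).
  have -> : fmod_s j *+ r = fmod_s j *~ c - (fmod_s j *+ 3) *~ (c %/ 3)%Z.
    by rewrite [_ *+ 3]pmulrn -mulrzA mulrC -mulrzBr {1}def_c addrAC subrr add0r.
  by rewrite fmvalA fmvalN groupM ?groupV // mulrz_closed.
case: r lt_r3 Lr def_c => [|[|[|]]] // _; first by rewrite addr0 mulrC.
  by rewrite mulr1n fmval_fmod_s.
move=> Lr; case: nLs; rewrite -fmval_fmod_s.
have -> : fmod_s j = fmod_s j *+ 3 - fmod_s j *+ 2.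
  by rewrite [_ *+ 3]mulrSr addrAC subrr add0r.
by rewrite fmvalA fmvalN groupM ?groupV.
Qed.

(** An element of Z[X, Y] killing the generator of the commutator subgroup
    modulo ever deeper terms of the lower central series lies in ever smaller
    ideals.  In the step, Y is a multiple of X modulo its own relation, so only
    the constant term of the cofactor of X^i matters; it has to be a multiple
    of 3, and modulo the cubic relation 3 is itself divisible by X. *)
Lemma polyact_lcn_ideal i f :
    (i <= n.+1)%N -> fmval (act (fmod_s 0) f) \in 'L_i.+2(G) ->
  exists p q r, f = p * pX ^+ i + q * (pY - gamma *: pX ^+ n) + r * T3.
Proof.
(* For n = 0 the monomial is constant, and only gamma = 0 makes it divisible
   by X. *)
have [e def_e] : exists e, gamma *: pX ^+ n = pX * e.
  have [/gamma0-> | n_gt0] := posnP n.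
    by exists 0; rewrite scale0r mulr0.
  by exists (gamma *: pX ^+ n.-1); rewrite -scalerAr -exprS prednK.
elim: i => [|i IHi] le_in Lf; first by exists f, 0, 0; ring.
have [p [q [r def_f]]] := IHi (ltnW le_in) (subsetP (lcn_subS _ _) _ Lf).
have [c [g [h def_p]]] := mpoly2_decomp p.
have [d def_c] : exists d, c = 3 * d.
  apply: (@mulrz_fmod_s_lcn i) => //.
  have act_f : act (fmod_s 0) f
      = fmod_s i *~ c + (act (fmod_s i.+1) g + act (act (fmod_s i) pY) h).
    rewrite def_f mulrC [q * _]mulrC [r * _]mulrC !polyactDr.
    rewrite !(@polyactM _ _ _ x y) //.
    rewrite polyact_sXn polyact_T3 polyact_Y !polyact0l !addr0 def_p.
    by rewrite !polyactDr polyactC !polyactM // polyact_sX addrA.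
  have -> : fmod_s i *~ c
      = act (fmod_s 0) f - (act (fmod_s i.+1) g + act (act (fmod_s i) pY) h).
    by rewrite act_f addrK.
  rewrite fmvalA fmvalN groupM ?groupV // fmvalA groupM //.
    by rewrite polyact_closed ?Nx ?Ny // fmval_fmod_s s_lcn.
  rewrite polyact_closed ?Nx ?Ny // polyactYr // fmval_actr_sub // fmval_fmod_s.
  exact: mem_commg (s_lcn i) Gy.
(* Substitute 3 = T3 - X (X + 3) and Y = (Y - gamma X^n) + X e in p X^i. *)
exists (g + e * h - (pX + 3) * d%:MP), (q + pX ^+ i * h), (r + pX ^+ i * d%:MP).
rewrite def_f def_p def_c def_e mpolyCM rmorph_nat.
rewrite /T3 [_ ^+ i.+1]exprS [pX ^+ 2]expr2.
move: (d%:MP) (pX ^+ i) => D Xi; ring.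
Qed.

Lemma annihilator_W_ideal f :
  annihilator x y f <-> W_ideal n.+1 gamma f.
Proof.
have annE : annihilator x y f <-> act (fmod_s 0) f = 0.
  rewrite /annihilator -[[~ y, x]%g]/(s 2) -(fmval_fmod_s 0) zact_eval_xy //.
  by split=> [/(@fmod_inj _ _ _ _ 0) | ->].
rewrite annE /W_ideal subn1 ideal_gen3P; split=> [f0 | [p [q [r ->]]]].
  by apply: polyact_lcn_ideal; rewrite // f0 fmval0.
rewrite mulrC [q * _]mulrC [r * _]mulrC !polyactDr !polyactM //.
by rewrite polyact_sXn fmod_s_eq0 polyact_T3 polyact_Y !polyact0l !addr0.
Qed.

(** The commutator [s_2, x^a] is congruent to s_3^a: modulo the fourth term of
    the series, commutation with x is additive in the exponent. *)
Lemma actr_expg_lcn a :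
  fmval (fmod_s 0 ^@ (x ^+ a)%g - fmod_s 0 - fmod_s 1 *+ a) \in 'L_4(G).
Proof.
elim: a => [|a IHa]; first by rewrite actr1 subrr subr0 fmval0.
set D := fmod_s 0 ^@ (x ^+ a)%g - fmod_s 0 in IHa.
have -> : fmod_s 0 ^@ (x ^+ a.+1)%g - fmod_s 0 = D ^@ x + fmod_s 1.
  rewrite /D -polyact_sX polyactXr // expgSr actrM ?groupX // actAr actNr.
  by rewrite [RHS]addrA subrK.
have -> : D ^@ x + fmod_s 1 - fmod_s 1 *+ a.+1
    = (D ^@ x - D) + (D - fmod_s 1 *+ a).
  by move: (D) => E; rewrite mulrS opprD !addrA addrK subrK.
rewrite fmvalA groupM //= fmval_actr_sub //; apply: mem_commg Gx.
by rewrite fmval_actr_sub ?groupX // fmval_fmod_s mem_commg ?groupX // (s_lcn 0).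
Qed.

Local Close Scope ring_scope.

(** Descending induction along the lower central series, each term being
    generated by s_j and the next term. *)
Lemma cent_y_L2 : gamma = 0%R -> y \in 'C('L_2(G)).
Proof.
move=> g0; suff cLy i : i <= n.+1 -> 'L_(n.+3 - i)(G) \subset 'C[y].
  by have := cLy _ (leqnn _); rewrite -[n.+3]/(2 + n.+1) addnK sub_cent1.
elim: i => [|i IHi] le_in; first by rewrite subn0 nilG sub1G.
have def_j : n.+3 - i = (n - i).+3 by rewrite !subSn // ltnW // ltnW.
have := IHi (ltnW le_in); rewrite subnS def_j /= => sLC.
have le_j : 2 <= (n - i).+2 <= n.+3.-1 by rewrite /= !ltnS leq_subr.
rewrite (rep_lcn repG le_j) gen_subG subUset sLC andbT sub1set.
apply/cent1P/commgP/eqP.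
case: (n - i) => [|j]; last exact: (rep_sjy repG).
by rewrite (rep_s2y repG) g0.
Qed.

(** When y centralises the commutator subgroup, an element of the two-step
    centraliser acts on it like a power x^a.  Commuting with s_2 modulo the
    fourth term of the series forces 3 to divide a, and x^3 is itself in the
    abelian commutator subgroup. *)
Lemma chi2_cent_L2 : 0 < n -> gamma = 0%R -> chi2 G \subset 'C('L_2(G)).
Proof.
move=> n_gt0 /cent_y_L2 cLy; set C := 'C('L_2(G)).
have nCG : G \subset 'N(C) by rewrite (subset_trans (lcn_norm 2 G)) ?cent_norm.
have sGxC : G \subset <[x]> <*> C.
  rewrite -{1}G_gen gen_subG subUset !sub1set.
  by rewrite mem_gen ?inE ?cycle_id // mem_gen // inE cLy orbT.
have nCx : <[x]> \subset 'N(C) by rewrite cycle_subG (subsetP nCG).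
apply/subsetP=> g /setIdP[Gg /forall_inP chi_g].
have := subsetP sGxC g Gg; rewrite norm_joinEl //.
case/mulsgP=> _ h /cycleP[a ->] Ch def_g; rewrite def_g.
have /(mulrz_fmod_s_lcn n_gt0)[d def_a] : fmval (fmod_s 1 *~ a)%R \in 'L_4(G).
  have -> : (fmod_s 1 *~ a = (fmod_s 0 ^@ (x ^+ a)%g - fmod_s 0)
                    - (fmod_s 0 ^@ (x ^+ a)%g - fmod_s 0 - fmod_s 1 *+ a))%R.
    by rewrite opprD opprK addrA subrr add0r.
  rewrite fmvalA fmvalN groupM ?groupV ?actr_expg_lcn //=.
  rewrite fmval_actr_sub ?groupX // fmval_fmod_s.
  have := chi_g _ (s_L2 0); rewrite def_g commgMJ.
  have L2x: [~ s 2, x ^+ a] \in 'L_2(G).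
    by rewrite commgEl groupM ?groupV ?s_L2 // memJ_norm ?groupX ?(s_L2 0).
  have /esym/commgP/eqP-> := centP Ch _ (s_L2 0).
  by have /esym/commgP/conjg_fixP-> := centP Ch _ L2x; rewrite mul1g.
have dvd3a : 3 %| a by have: (3 %| Posz a)%Z; [rewrite def_a dvdz_mulr|].
rewrite groupM // -(divnK dvd3a) mulnC expgM groupX // (rep_x3 repG).
have Ls: s n.+2 \in C by rewrite (subsetP abL2) // s_L2.
by case: (alpha) => k; rewrite /= ?groupV groupX.
Qed.

Lemma commg_chi2_eq1 :
    0 < n -> gamma \in [:: (-1)%R; 0%R; 1%R] ->
  [~: 'L_2(G), chi2 G] = 1 <-> gamma = 0%R.
Proof.
move=> n_gt0 gammaE; split=> [cL | g0]; last first.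
  by apply/commG1P; rewrite centsC chi2_cent_L2.
have [_ _ _ /setDP[chi_y _]] := rep_gens repG.
have := mem_commg (s_L2 0) chi_y; rewrite cL (rep_s2y repG) => /set1P /eqP.
have /negPf s_n1 : s n.+2 != 1 by rewrite (rep_sj_neq1 repG) /=.
by move: gammaE; rewrite !inE => /or3P[]/eqP-> //=;
  rewrite ?expg1 ?invg_eq1 s_n1.
Qed.

Lemma defect_gamma (k : nat) :
    has_defect G n.+3 k -> k <= 1 -> gamma \in [:: (-1)%R; 0%R; 1%R] ->
  k = 0 <-> gamma = 0%R.
Proof.
rewrite /has_defect -[n.+3 < 4]/(n < 1) ltnS leqn0.
case: posnP => [n0 -> _ _ | n_gt0 def_k].
  by split=> // _; apply: gamma0.
move=> le_k1 /(commg_chi2_eq1 n_gt0) <-; rewrite def_k.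
case: k le_k1 {def_k} => [|[|]] // _; rewrite ?subn0 ?nilG // subn1 /=.
split=> // L1; have := s_lcn n; rewrite L1 => /set1P/eqP.
by rewrite (negPf (rep_sj_neq1 repG _)) /=.
Qed.

End MaximalClass.

Theorem theorem3p1 (gT : finGroupType) (G : {group gT}) (m k : nat)
    (alpha beta gamma : int) (x y : gT) :
  metabelian G ->
  (3.-group G)%g ->
  coclass 3 G = 1%N ->
  #|G| = (3 ^ m)%N ->
  nil_class G = (m - 1)%N ->
  (2 <= m - 1)%N ->
  has_defect G m k ->
  (0 <= k <= 1)%N ->
  alpha \in [:: (-1)%R; 0%R; 1%R] ->
  beta \in [:: (-1)%R; 0%R; 1%R] ->
  gamma \in [:: (-1)%R; 0%R; 1%R] ->
  ((m <= 4)%N -> gamma = 0%R) ->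
  is_representative m alpha beta gamma G x y ->
  [/\ forall f : {mpoly int[2]},
        annihilator x y f <-> W_ideal (m - 2) gamma f,
      k = 0%N <-> gamma = 0%R
    & k = 0%N -> forall f : {mpoly int[2]},
        annihilator x y f <-> Y_ideal (m - 2) f].
Proof.
move=> metabG pG _ _; case: m => [|[|[|n]]] //; rewrite subSS subn0 => clG _.
move=> defG /andP[_ le_k1] _ _ gammaE gamma_m4 repG.
have gamma0 : n = 0 -> gamma = 0%R by move=> n0; apply: gamma_m4; rewrite n0.
have nilG : 'L_n.+3(G) = 1.
  by apply/(lcn_nil_classP _ (pgroup_nil pG)); rewrite clG.
have annE f : annihilator x y f <-> W_ideal (n.+3 - 2) gamma f.
  by rewrite !subSS subn0; apply: annihilator_W_ideal gamma0 repG f.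
have k_gamma := defect_gamma metabG nilG gamma0 repG defG le_k1 gammaE.
split=> // /k_gamma g0 f; rewrite annE /W_ideal /Y_ideal g0.
by rewrite scale0r subr0.
Qed.
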